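(* Let $\gamma \geq 0$ be an integer and $b \in [\gamma]$. The element $$\bullet_b := \pi\Big(\sum_{a \in [b]} \leftharpoonup_a + \rightharpoonup_a\Big)$$ of $\mathsf{Dendr}_\gamma$, where $\pi : \mathbf{Free}(\{\leftharpoonup_a, \rightharpoonup_a : a \in [\gamma]\}) \to \mathsf{Dendr}_\gamma$ is the canonical surjection map, is associative.
   Context: The ground field has characteristic zero; operad means nonsymmetric operad; $[n] = \{1, \dots, n\}$; $a \uparrow a' := \max(a, a')$. An element $x$ of arity $2$ of an operad is associative if $x \circ_1 x = x \circ_2 x$. $\mathbf{Free}(\mathfrak{G})$ is the free operad on a set $\mathfrak{G}$ of binary generators. Koszul dual: if $\mathcal{O}$ has a presentation $(\mathfrak{G}, \mathfrak{R})$ (that is, $\mathcal{O} \cong \mathbf{Free}(\mathfrak{G})/\langle \mathfrak{R} \rangle$) with $\mathfrak{G}$ in arity $2$ and $\mathfrak{R} \subseteq \mathbf{Free}(\mathfrak{G})(3)$, its Koszul dual is $\mathbf{Free}(\mathfrak{G})/\langle \mathfrak{R}^\perp \rangle$, where $\mathfrak{R}^\perp$ is the annihilator of $\mathfrak{R}$ in $\mathbf{Free}(\mathfrak{G})(3)$ for the bilinear form with $\langle x \circ_i y, x' \circ_{i'} y' \rangle = 1$ if $x = x', y = y', i = i' = 1$; $= -1$ if $x = x', y = y', i = i' = 2$; and $0$ otherwise ($x, x', y, y' \in \mathfrak{G}$). $\mathsf{Dias}_\gamma$ is the operad presented by binary generators $\dashv_a, \vdash_a$, $a \in [\gamma]$,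 and the space of relations spanned, for all $a, a' \in [\gamma]$, by $\dashv_a \circ_1 \vdash_{a'} - \vdash_{a'} \circ_2 \dashv_a$; $\dashv_a \circ_1 \dashv_{a \uparrow a'} - \dashv_a \circ_2 \vdash_{a'}$; $\vdash_a \circ_1 \dashv_{a'} - \vdash_a \circ_2 \vdash_{a \uparrow a'}$; $\dashv_{a \uparrow a'} \circ_1 \dashv_a - \dashv_a \circ_2 \dashv_{a'}$; $\vdash_a \circ_1 \vdash_{a'} - \vdash_{a \uparrow a'} \circ_2 \vdash_a$. $\mathsf{Dendr}_\gamma$ is the Koszul dual of $\mathsf{Dias}_\gamma$ computed from this presentation, where in the dual the generators corresponding to $\dashv_a$ and $\vdash_a$ are denoted by $\leftharpoonup_a$ and $\rightharpoonup_a$ respectively. *)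

(* Defs.v *)
From HB Require Import structures.
From mathcomp Require Import all_boot all_order all_algebra.
From mathcomp Require Import boolp.
From mathcomp Require Import finmap.
From mathcomp.multinomials Require Import monalg.

Set Implicit Arguments.
Unset Strict Implicit.
Unset Printing Implicit Defensive.

Import Order.TTheory GRing.Theory.
Local Open Scope ring_scope.

(** A nonsymmetric operad in [K]-vector spaces.

    Degrees are shifted by one, so that no arity-0 component and no truncated
    subtraction appear: [O n] is the component of arity [n.+1].  The input
    positions are 0-based: for [x : O m] and [i : 'I_m.+1], [op_comp x i y] is
    the partial composition usually written with the index [i.+1]; it has arity
    [m.+1 + n.+1 - 1 = (m + n).+1]. *)
Record operad (K : fieldType) := Operad {
  op_sort :> nat -> lmodType K;
  op_unit : op_sort 0;
  op_comp : forall m n, op_sort m -> 'I_m.+1 -> op_sort n -> op_sort (m + n);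
  op_comp_linl : forall m n (i : 'I_m.+1) (y : op_sort n),
    linear (fun x : op_sort m => op_comp x i y);
  op_comp_linr : forall m n (x : op_sort m) (i : 'I_m.+1),
    linear (fun y : op_sort n => op_comp x i y);
  op_comp_seq : forall m n p (x : op_sort m) (y : op_sort n) (z : op_sort p)
      (i : 'I_m.+1) (j : 'I_n.+1) (k : 'I_(m + n).+1),
    k = (i + j)%N :> nat ->
    op_comp x i (op_comp y j z) =
      ecast d (op_sort d) (esym (addnA m n p)) (op_comp (op_comp x i y) k z);
  op_comp_par : forall m n p (x : op_sort m) (y : op_sort n) (z : op_sort p)
      (i j : 'I_m.+1) (i' : 'I_(m + p).+1) (j' : 'I_(m + n).+1),
    (i < j)%N -> i' = i :> nat -> j' = (j + n)%N :> nat ->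
    op_comp (op_comp x j z) i' y =
      ecast d (op_sort d) (addnAC m n p) (op_comp (op_comp x i y) j' z);
  op_comp1l : forall n (x : op_sort n), op_comp op_unit ord0 x = x;
  op_comp1r : forall n (x : op_sort n) (i : 'I_n.+1),
    op_comp x i op_unit = ecast d (op_sort d) (esym (addn0 n)) x
}.

Arguments op_comp {K o m n} x i y.

(** The two partial compositions of elements of arity 2. *)
Notation "x \o1 y" := (@op_comp _ _ 1 1 x ord0 y)
  (at level 30, no associativity) : ring_scope.
Notation "x \o2 y" := (@op_comp _ _ 1 1 x ord_max y)
  (at level 30, no associativity) : ring_scope.

Definition associative_elt (K : fieldType) (O : operad K) (x : O 1%N) : Prop :=
  x \o1 x = x \o2 x.

Section LinearSpan.
Variables (K : fieldType) (V : lmodType K) (P : V -> Prop).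

Inductive lspan : V -> Prop :=
| lspan_in v : P v -> lspan v
| lspan_0 : lspan 0
| lspan_lin a u v : lspan u -> lspan v -> lspan (a *: u + v).

End LinearSpan.

(** Quotient of a vector space by a subspace; the library provides the
    underlying additive group.  The argument [hS] of [subspace] only serves to
    attach the closure properties to [S]. *)
Section QuotientModule.
Variables (K : fieldType) (V : lmodType K) (S : {pred V}).

Definition subspace (hS : submod_closed S) : {pred V} := S.

Variable hS : submod_closed S.

HB.instance Definition _ :=
  GRing.isSubmodClosed.Build K V (subspace hS) hS.

Definition qmod := Quotient.quot (subspace hS).

HB.instance Definition _ := GRing.Zmodule.on qmod.

Definition qmod_pi : V -> qmod := \pi_qmod%qT.
Definition qmod_repr : qmod -> V := @generic_quotient.repr _ _.

Lemma qmod_reprK : cancel qmod_repr qmod_pi.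
Proof. exact: generic_quotient.reprK. Qed.

Lemma qmod_piE (x y : V) : qmod_pi x = qmod_pi y <-> (x - y \in S).
Proof. by rewrite (Quotient.idealrBE (subspace hS)); split=> /eqP. Qed.

Lemma qmod_piD : {morph qmod_pi : x y / x + y}.
Proof. exact: raddfD. Qed.

Definition qmod_scale (a : K) (x : qmod) : qmod := qmod_pi (a *: qmod_repr x).

Lemma qmod_piZ a : {morph qmod_pi : x / a *: x >-> qmod_scale a x}.
Proof.
move=> x; apply/qmod_piE; rewrite -scalerBr.
by apply: (@rpredZ _ _ (subspace hS)); apply/qmod_piE; rewrite qmod_reprK.
Qed.

Fact qmod_scaleA a b x :
  qmod_scale a (qmod_scale b x) = qmod_scale (a * b) x.
Proof. by rewrite -[x]qmod_reprK -!qmod_piZ scalerA. Qed.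

Fact qmod_scale1 : left_id 1 qmod_scale.
Proof. by move=> x; rewrite -[x]qmod_reprK -qmod_piZ scale1r. Qed.

Fact qmod_scaleDr : right_distributive qmod_scale +%R.
Proof.
move=> a x y; rewrite -[x]qmod_reprK -[y]qmod_reprK.
by rewrite -!qmod_piZ -!qmod_piD -qmod_piZ scalerDr.
Qed.

Fact qmod_scaleDl x : {morph qmod_scale^~ x : a b / a + b}.
Proof.
by move=> a b; rewrite -[x]qmod_reprK -!qmod_piZ scalerDl qmod_piD.
Qed.

HB.instance Definition _ := GRing.Zmodule_isLmodule.Build K qmod
  qmod_scaleA qmod_scale1 qmod_scaleDr qmod_scaleDl.

Lemma qmod_pi_linear : linear qmod_pi.
Proof. by move=> a x y; rewrite qmod_piD qmod_piZ. Qed.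

End QuotientModule.

Section QuotientOperad.
Variables (K : fieldType) (O : operad K) (d : nat) (R : O d -> Prop).

(** The operadic ideal generated by [R]: the smallest family of subspaces
    containing [R] and stable under partial composition on either side. *)
Inductive op_ideal : forall n, O n -> Prop :=
| op_ideal_rel x : R x -> op_ideal x
| op_ideal_0 n : op_ideal (0 : O n)
| op_ideal_lin n a (x y : O n) :
    op_ideal x -> op_ideal y -> op_ideal (a *: x + y)
| op_ideal_compl m n (x : O m) i (y : O n) :
    op_ideal x -> op_ideal (op_comp x i y)
| op_ideal_compr m n (x : O m) i (y : O n) :
    op_ideal y -> op_ideal (op_comp x i y).

Definition op_ideal_pred n : {pred O n} := fun x => `[< op_ideal x >].

Fact op_ideal_submod n : submod_closed (@op_ideal_pred n).
Proof.
split; first by apply/asboolP; exact: op_ideal_0.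
by move=> a x y /asboolP hx /asboolP hy; apply/asboolP; exact: op_ideal_lin.
Qed.

Definition qop_sort n : lmodType K := qmod (op_ideal_submod n).

Definition qop_pi n : O n -> qop_sort n := @qmod_pi _ _ _ (op_ideal_submod n).
Definition qop_repr n : qop_sort n -> O n :=
  @qmod_repr _ _ _ (op_ideal_submod n).

Definition qop_unit : qop_sort 0 := qop_pi (op_unit O).

Definition qop_comp m n (x : qop_sort m) (i : 'I_m.+1) (y : qop_sort n) :
    qop_sort (m + n) :=
  qop_pi (op_comp (qop_repr x) i (qop_repr y)).

Lemma qop_reprK n : cancel (@qop_repr n) (@qop_pi n).
Proof. exact: qmod_reprK. Qed.

Lemma qop_piE n (x y : O n) : qop_pi x = qop_pi y <-> op_ideal (x - y).
Proof.
split=> [/qmod_piE /asboolP //|h].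
by apply/qmod_piE/asboolP.
Qed.

Lemma qop_pi_surj n (x : qop_sort n) : exists y, x = qop_pi y.
Proof.
by exists (qop_repr x); rewrite qop_reprK.
Qed.

Lemma qop_pi_linear n : linear (@qop_pi n).
Proof. exact: qmod_pi_linear. Qed.

Lemma qop_pi_comp m n (x : O m) i (y : O n) :
  qop_pi (op_comp x i y) = qop_comp (qop_pi x) i (qop_pi y).
Proof.
have rep k (z : O k) : op_ideal (z - qop_repr (qop_pi z)).
  by apply/qop_piE; rewrite qop_reprK.
rewrite /qop_comp.
move: (rep _ x) (rep _ y); set x' := qop_repr _.
set y' := qop_repr _ => hx hy.
apply: (@eq_trans _ _ (qop_pi (op_comp x' i y))); apply/qop_piE.
  have -> : op_comp x i y - op_comp x' i y = op_comp (x - x') i y.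
    have -> : x - x' = -1 *: x' + x by rewrite scaleN1r addrC.
    by rewrite op_comp_linl scaleN1r addrC.
  exact: op_ideal_compl.
have -> : op_comp x' i y - op_comp x' i y' = op_comp x' i (y - y').
  have -> : y - y' = -1 *: y' + y by rewrite scaleN1r addrC.
  by rewrite op_comp_linr scaleN1r addrC.
exact: op_ideal_compr.
Qed.

Let qop_cast m n (e : m = n) (x : O m) :
  ecast k (qop_sort k) e (qop_pi x) = qop_pi (ecast k (O k) e x).
Proof. by case: n / e. Qed.

Fact qop_comp_linl m n (i : 'I_m.+1) (y : qop_sort n) :
  linear (fun x : qop_sort m => qop_comp x i y).
Proof.
move=> a x x'; have [{}y ->] := qop_pi_surj y.
have [{}x ->] := qop_pi_surj x; have [{}x' ->] := qop_pi_surj x'.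
by rewrite -qop_pi_linear -!qop_pi_comp op_comp_linl qop_pi_linear.
Qed.

Fact qop_comp_linr m n (x : qop_sort m) (i : 'I_m.+1) :
  linear (fun y : qop_sort n => qop_comp x i y).
Proof.
move=> a y y'; have [{}x ->] := qop_pi_surj x.
have [{}y ->] := qop_pi_surj y; have [{}y' ->] := qop_pi_surj y'.
by rewrite -qop_pi_linear -!qop_pi_comp op_comp_linr qop_pi_linear.
Qed.

Fact qop_comp_seq m n p (x : qop_sort m) (y : qop_sort n) (z : qop_sort p)
    (i : 'I_m.+1) (j : 'I_n.+1) (k : 'I_(m + n).+1) :
  k = (i + j)%N :> nat ->
  qop_comp x i (qop_comp y j z) =
    ecast d (qop_sort d) (esym (addnA m n p)) (qop_comp (qop_comp x i y) k z).
Proof.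
move=> hk; have [{}x ->] := qop_pi_surj x; have [{}y ->] := qop_pi_surj y.
have [{}z ->] := qop_pi_surj z.
by rewrite -!qop_pi_comp qop_cast (op_comp_seq _ _ _ hk).
Qed.

Fact qop_comp_par m n p (x : qop_sort m) (y : qop_sort n) (z : qop_sort p)
    (i j : 'I_m.+1) (i' : 'I_(m + p).+1) (j' : 'I_(m + n).+1) :
  (i < j)%N -> i' = i :> nat -> j' = (j + n)%N :> nat ->
  qop_comp (qop_comp x j z) i' y =
    ecast d (qop_sort d) (addnAC m n p) (qop_comp (qop_comp x i y) j' z).
Proof.
move=> hij hi hj; have [{}x ->] := qop_pi_surj x.
have [{}y ->] := qop_pi_surj y; have [{}z ->] := qop_pi_surj z.
by rewrite -!qop_pi_comp qop_cast (op_comp_par _ _ _ hij hi hj).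
Qed.

Fact qop_comp1l n (x : qop_sort n) : qop_comp qop_unit ord0 x = x.
Proof.
have [{}x ->] := qop_pi_surj x.
by rewrite -qop_pi_comp op_comp1l.
Qed.

Fact qop_comp1r n (x : qop_sort n) (i : 'I_n.+1) :
  qop_comp x i qop_unit = ecast d (qop_sort d) (esym (addn0 n)) x.
Proof.
have [{}x ->] := qop_pi_surj x.
by rewrite -qop_pi_comp op_comp1r qop_cast.
Qed.

Definition quotient_operad : operad K :=
  Operad qop_comp_linl qop_comp_linr qop_comp_seq qop_comp_par
    qop_comp1l qop_comp1r.

(** The canonical surjection. *)
Definition op_pi n : O n -> quotient_operad n := @qop_pi n.

End QuotientOperad.

(** Planar binary trees with internal nodes labelled by generators. *)
Section BinaryTrees.
Variable G : choiceType.

Inductive btree := Leaf | Node of G & btree & btree.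

Fixpoint btree_enc (t : btree) : GenTree.tree G :=
  match t with
  | Leaf => GenTree.Node 0 [::]
  | Node x l r => GenTree.Node 1 [:: GenTree.Leaf x; btree_enc l; btree_enc r]
  end.

Fixpoint btree_dec (t : GenTree.tree G) : option btree :=
  match t with
  | GenTree.Node 0 [::] => Some Leaf
  | GenTree.Node 1 [:: GenTree.Leaf x; l; r] =>
      if btree_dec l is Some l' then
        if btree_dec r is Some r' then Some (Node x l' r') else None
      else None
  | _ => None
  end.

Lemma btree_encK : pcancel btree_enc btree_dec.
Proof. by elim=> //= x l -> r ->. Qed.

HB.instance Definition _ := Equality.copy btree (pcan_type btree_encK).
HB.instance Definition _ := Choice.copy btree (pcan_type btree_encK).

Fixpoint nodes (t : btree) : nat :=
  if t is Node _ l r then (nodes l + nodes r).+1 else 0%N.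

(** [graft t i s] plugs [s] into the [i]-th leaf of [t], leaves being numbered
    from left to right starting at 0; a tree [l] has [(nodes l).+1] leaves.
    (The value for [i > nodes t] is irrelevant.) *)
Fixpoint graft (t : btree) (i : nat) (s : btree) : btree :=
  match t with
  | Leaf => s
  | Node x l r =>
      if (i <= nodes l)%N then Node x (graft l i s) r
      else Node x l (graft r (i - (nodes l).+1) s)
  end.

Lemma nodes_graft t i s : nodes (graft t i s) = (nodes t + nodes s)%N.
Proof.
elim: t i => //= x l IHl r IHr i.
by case: ifP => _ /=; rewrite ?IHl ?IHr addSn ?addnA // addnAC.
Qed.

Lemma graft_seq t i s j u : (i <= nodes t)%N -> (j <= nodes s)%N ->
  graft (graft t i s) (i + j) u = graft t i (graft s j u).
Proof.
move=> + hj; elim: t i => [|x l IHl r IHr] i /=.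
  by rewrite leqn0 => /eqP->.
move=> hi; case: leqP => hil /=.
  by rewrite nodes_graft leq_add // IHl.
rewrite leqNgt ltn_addr //=; congr Node.
by rewrite addnC -addnBA // addnC IHr // leq_subLR addSn.
Qed.

Lemma graft_par t i j s u : (i < j)%N -> (j <= nodes t)%N ->
  graft (graft t i s) (j + nodes s) u = graft (graft t j u) i s.
Proof.
elim: t i j => [|x l IHl r IHr] i j hij /=.
  by rewrite leqn0 => /eqP hj; rewrite hj in hij.
move=> hj; case: (leqP j (nodes l)) => hjl /=.
  have hil : (i <= nodes l)%N by apply: leq_trans hjl; exact: ltnW.
  by rewrite hil /= !nodes_graft leq_add2r hjl (leq_trans hil) ?leq_addr // IHl.
case: (leqP i (nodes l)) => hil /=.
  rewrite nodes_graft leq_add2r leqNgt hjl /=; congr Node.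
  by congr graft; rewrite -addSn subnDr.
have -> : (j + nodes s <= nodes l)%N = false.
  by apply/negbTE; rewrite -ltnNge ltn_addr.
congr Node; rewrite [(j + _)%N]addnC -addnBA // addnC IHr //.
  by rewrite ltn_sub2r // (leq_trans _ hij).
by rewrite leq_subLR addSn.
Qed.

Lemma graft_leaf t i : graft t i Leaf = t.
Proof. by elim: t i => //= x l IHl r IHr i; case: ifP; rewrite ?IHl ?IHr. Qed.

Definition wtree (n : nat) := {t : btree | nodes t == n}.

Fact wgraft_subproof m n (t : wtree m) (i : 'I_m.+1) (s : wtree n) :
  nodes (graft (val t) i (val s)) == (m + n)%N.
Proof. by rewrite nodes_graft (eqP (valP t)) (eqP (valP s)). Qed.

Definition wgraft m n (t : wtree m) (i : 'I_m.+1) (s : wtree n) :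
  wtree (m + n) :=
  exist _ (graft (val t) i (val s)) (wgraft_subproof t i s).

Definition wleaf : wtree 0 := exist _ Leaf isT.

Definition corolla (x : G) : wtree 1 := exist _ (Node x Leaf Leaf) isT.

End BinaryTrees.

Arguments Leaf {G}.

Section LinearExtension.
Variables (K : fieldType) (T : choiceType) (V : lmodType K) (h : T -> V).

Definition lin_ext (f : {malg K[T]}) : V := \sum_(t <- msupp f) f@_t *: h t.

Lemma lin_extEw (D : {fset T}) f : (msupp f `<=` D)%fset ->
  lin_ext f = \sum_(t <- D) f@_t *: h t.
Proof.
move=> le; rewrite [LHS](big_fset_incl _ le) // => t _ /mcoeff_outdom ->.
by rewrite scale0r.
Qed.

Lemma lin_ext_linear : linear lin_ext.
Proof.
move=> a f g; pose D := (msupp f `|` msupp g `|` msupp (a *: f + g))%fset.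
have hf : (msupp f `<=` D)%fset by rewrite /D -fsetUA fsubsetUl.
have hg : (msupp g `<=` D)%fset.
  by rewrite /D -fsetUA fsetUCA fsubsetUl.
have hfg : (msupp (a *: f + g) `<=` D)%fset by rewrite /D fsubsetUr.
rewrite !(lin_extEw hf, lin_extEw hg, lin_extEw hfg) scaler_sumr -big_split /=.
by apply: eq_bigr => t _; rewrite mcoeffD mcoeffZ scalerDl scalerA.
Qed.

Lemma lin_extU t : lin_ext << t >> = h t.
Proof.
by rewrite (lin_extEw msuppU_le) big_seq_fset1 mcoeffUU scale1r.
Qed.

End LinearExtension.

Lemma linear_fun0 (K : fieldType) (U V : lmodType K) (f : U -> V) :
  linear f -> f 0 = 0.
Proof.
by move=> lf; have := lf (-1) 0 0; rewrite scaler0 addr0 scaleN1r addNr.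
Qed.

Lemma malg_lin_ind (K : fieldType) (T : choiceType) (P : {malg K[T]} -> Prop) :
  P 0 -> (forall t, P << t >>) ->
  (forall a f g, P f -> P g -> P (a *: f + g)) ->
  forall f, P f.
Proof.
move=> P0 PU Plin f; rewrite (monalgE f).
elim/big_rec: _ => // t g _ Pg.
have -> : << f@_t *g t >> = f@_t *: << t >> :> {malg K[T]}.
  by apply/malgP => s; rewrite mcoeffZ !mcoeffU mulr_natr.
exact: Plin.
Qed.

Definition free_sort (K : fieldType) (G : choiceType) (n : nat) : lmodType K :=
  {malg K[wtree G n]}.

(** Basis element attached to a tree.  This definition and [free_comp] are locked
    because comparing two unfolded monomials by conversion is intractable. *)
HB.lock Definition free_tree (K : fieldType) (G : choiceType) (n : nat)
  (t : wtree G n) : free_sort K G n := << t >>.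

Arguments free_tree K {G n} t.

Lemma malg_basisE (K : fieldType) (T : choiceType) (t s : T) :
  (<< t >> : {malg K[T]})@_s = (t == s)%:R.
Proof. exact: mcoeffU. Qed.

Lemma free_tree_coef (K : fieldType) (G : choiceType) n (t s : wtree G n) :
  (free_tree K t : {malg K[wtree G n]})@_s = (t == s)%:R.
Proof. by rewrite free_tree.unlock malg_basisE. Qed.

Lemma free_tree_supp (K : fieldType) (G : choiceType) n (t : wtree G n) :
  (msupp (free_tree K t : {malg K[wtree G n]}) `<=` [fset t])%fset.
Proof. by rewrite free_tree.unlock msuppU_le. Qed.

HB.lock Definition free_comp (K : fieldType) (G : choiceType) (m n : nat)
    (f : free_sort K G m) (i : 'I_m.+1) (g : free_sort K G n) :
    free_sort K G (m + n) :=
  lin_ext (fun t => lin_ext (fun s => free_tree K (wgraft t i s)) g) f.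

Arguments free_comp {K G m n} f i g.

Section FreeOperad.
Variables (K : fieldType) (G : choiceType).
Local Notation free_sort := (free_sort K G).
Local Notation free_tree := (free_tree K).

Lemma free_ind n (P : free_sort n -> Prop) :
  P 0 -> (forall t, P (free_tree t)) ->
  (forall a (f g : free_sort n), P f -> P g -> P (a *: f + g)) ->
  forall f, P f.
Proof. by rewrite free_tree.unlock => P0 PU Plin; exact: malg_lin_ind. Qed.

Definition free_unit : free_sort 0 := free_tree (wleaf G).

Lemma free_comp_tree m n (t : wtree G m) (i : 'I_m.+1) (s : wtree G n) :
  free_comp (free_tree t) i (free_tree s) = free_tree (wgraft t i s).
Proof. by rewrite free_comp.unlock free_tree.unlock !lin_extU. Qed.

Fact free_comp_linl m n (i : 'I_m.+1) (g : free_sort n) :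
  linear (fun f : free_sort m => free_comp f i g).
Proof. by rewrite free_comp.unlock; exact: lin_ext_linear. Qed.

Fact free_comp_linr m n (f : free_sort m) (i : 'I_m.+1) :
  linear (fun g : free_sort n => free_comp f i g).
Proof.
move=> a g h; rewrite free_comp.unlock /lin_ext scaler_sumr -big_split /=.
apply: eq_bigr => t _.
by rewrite -[\sum_(k <- msupp (_ + _)) _]/(lin_ext _ _) lin_ext_linear
           scalerDr !scalerA mulrC.
Qed.

Let comp0l m n i (g : free_sort n) : free_comp (0 : free_sort m) i g = 0.
Proof. exact: (linear_fun0 (free_comp_linl i g)). Qed.

Let comp0r m n (f : free_sort m) i : free_comp f i (0 : free_sort n) = 0.
Proof. exact: (linear_fun0 (free_comp_linr f i)). Qed.

Let compPl m n a f g i (h : free_sort n) :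
  free_comp (a *: f + g : free_sort m) i h =
  a *: free_comp f i h + free_comp g i h.
Proof. exact: free_comp_linl. Qed.

Let compPr m n (f : free_sort m) i a g h :
  free_comp f i (a *: g + h : free_sort n) =
  a *: free_comp f i g + free_comp f i h.
Proof. exact: free_comp_linr. Qed.

Let castP m n (e : m = n) a (f g : free_sort m) :
  ecast d (free_sort d) e (a *: f + g) =
  a *: ecast d (free_sort d) e f + ecast d (free_sort d) e g.
Proof. by case: n / e. Qed.

Let cast0 m n (e : m = n) : ecast d (free_sort d) e 0 = 0.
Proof. by case: n / e. Qed.

Let eq_lin n a (f f' g g' : free_sort n) :
  f = f' -> g = g' -> a *: f + g = a *: f' + g'.
Proof. by move=> -> ->. Qed.

Let castU m n (e : m = n) (t : wtree G m) (s : wtree G n) :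
  val t = val s -> ecast d (free_sort d) e (free_tree t) = free_tree s.
Proof. by case: n / e s => s /val_inj ->. Qed.

Fact free_comp_seq m n p (x : free_sort m) (y : free_sort n)
    (z : free_sort p) (i : 'I_m.+1) (j : 'I_n.+1) (k : 'I_(m + n).+1) :
  k = (i + j)%N :> nat ->
  free_comp x i (free_comp y j z) =
    ecast d (free_sort d) (esym (addnA m n p))
      (free_comp (free_comp x i y) k z).
Proof.
move=> hk; elim/free_ind: x => [|t|a x x' IH IH'].
- by rewrite !comp0l cast0.
- elim/free_ind: y => [|s|a y y' IH IH'].
  + by rewrite !(comp0l, comp0r) cast0.
  + elim/free_ind: z => [|u|a z z' IH IH'].
    * by rewrite !comp0r cast0.
    * rewrite !free_comp_tree; apply/esym/castU => /=.
      rewrite hk graft_seq // ?(eqP (valP t)) ?(eqP (valP s)) -ltnS //.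
    * rewrite 2!compPr [in RHS]compPr castP; exact: (eq_lin a IH IH').
  + rewrite compPl compPr [in RHS]compPr compPl castP; exact: (eq_lin a IH IH').
- rewrite compPl [in RHS]compPl [in RHS]compPl castP; exact: (eq_lin a IH IH').
Qed.

Fact free_comp_par m n p (x : free_sort m) (y : free_sort n)
    (z : free_sort p) (i j : 'I_m.+1) (i' : 'I_(m + p).+1)
    (j' : 'I_(m + n).+1) :
  (i < j)%N -> i' = i :> nat -> j' = (j + n)%N :> nat ->
  free_comp (free_comp x j z) i' y =
    ecast d (free_sort d) (addnAC m n p) (free_comp (free_comp x i y) j' z).
Proof.
move=> hij hi hj; elim/free_ind: x => [|t|a x x' IH IH'].
- by rewrite !comp0l cast0.
- elim/free_ind: y => [|s|a y y' IH IH'].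
  + by rewrite !(comp0l, comp0r) cast0.
  + elim/free_ind: z => [|u|a z z' IH IH'].
    * by rewrite !(comp0l, comp0r) cast0.
    * rewrite !free_comp_tree; apply/esym/castU => /=.
      rewrite hi hj -[X in (j + X)%N](eqP (valP s)) graft_par // (eqP (valP t)) -ltnS //.
    * rewrite compPr [in RHS]compPr compPl castP; exact: (eq_lin a IH IH').
  + rewrite compPr [in RHS]compPr compPl castP; exact: (eq_lin a IH IH').
- rewrite compPl compPl [in RHS]compPl [in RHS]compPl castP; exact: (eq_lin a IH IH').
Qed.

Fact free_comp1l n (x : free_sort n) : free_comp free_unit ord0 x = x.
Proof.
elim/free_ind: x => [|t|a x x' IH IH'].
- exact: comp0r.
- rewrite free_comp_tree; congr free_tree; exact: val_inj.
- by rewrite compPr IH IH'.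
Qed.

Fact free_comp1r n (x : free_sort n) (i : 'I_n.+1) :
  free_comp x i free_unit = ecast d (free_sort d) (esym (addn0 n)) x.
Proof.
elim/free_ind: x => [|t|a x x' IH IH'].
- by rewrite comp0l cast0.
- rewrite free_comp_tree; apply/esym/castU => /=; by rewrite graft_leaf.
- by rewrite compPl castP IH IH'.
Qed.

(** The free operad: [free_operad K G n] has a basis formed of the binary trees
    with [n] internal nodes, hence [n.+1] leaves. *)
Definition free_operad : operad K :=
  Operad free_comp_linl free_comp_linr free_comp_seq free_comp_par
    free_comp1l free_comp1r.

Definition gen (x : G) : free_operad 1%N := free_tree (corolla x).

Lemma gen_comp (x y : G) (i : 'I_2) :
  op_comp (gen x) i (gen y) = free_tree (wgraft (corolla x) i (corolla y)).
Proof. exact: free_comp_tree. Qed.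

End FreeOperad.

Section KoszulDual.
Variables (K : fieldType) (G : choiceType).
Local Notation Free := (free_operad K G).

(** The operad with binary generators [G] and relations [R], in arity 3. *)
Definition presented (R : Free 2%N -> Prop) : operad K :=
  quotient_operad R.

(** A basis tree of arity 3 is [x \o1 y] when its lower node is a left child and
    [x \o2 y] when it is a right child.  Lemma [koszul_form_gen] below gives the
    values of the bilinear form on this basis. *)
Definition koszul_sign (t : wtree G 2) : K :=
  match val t with
  | Node _ (Node _ _ _) Leaf => 1
  | Node _ Leaf (Node _ _ _) => -1
  | _ => 0
  end.

Definition koszul_form (f g : {malg K[wtree G 2]}) : K :=
  \sum_(t <- msupp f) koszul_sign t * f@_t * g@_t.

Lemma koszul_formEw (D : {fset wtree G 2}) f g : (msupp f `<=` D)%fset ->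
  koszul_form f g = \sum_(t <- D) koszul_sign t * f@_t * g@_t.
Proof.
move=> le; rewrite [LHS](big_fset_incl _ le) // => t _ /mcoeff_outdom ->.
by rewrite mulr0 mul0r.
Qed.

Lemma koszul_form_linl a (f f' g : {malg K[wtree G 2]}) :
  koszul_form (a *: f + f') g = a * koszul_form f g + koszul_form f' g.
Proof.
pose D := (msupp f `|` msupp f' `|` msupp (a *: f + f'))%fset.
rewrite !(@koszul_formEw D) /D -?fsetUA ?fsubsetUl //; first last.
- by rewrite fsetUA fsubsetUr.
- by rewrite fsetUCA fsubsetUl.
rewrite mulr_sumr -big_split /=; apply: eq_bigr => t _.
by rewrite mcoeffD mcoeffZ mulrDr mulrDl mulrCA !mulrA.
Qed.

Lemma koszul_form_linr a (f g g' : {malg K[wtree G 2]}) :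
  koszul_form f (a *: g + g') = a * koszul_form f g + koszul_form f g'.
Proof.
rewrite /koszul_form mulr_sumr -big_split /=; apply: eq_bigr => t _.
by rewrite mcoeffD mcoeffZ mulrDr mulrCA.
Qed.

Lemma koszul_form_tree (t s : wtree G 2) :
  koszul_form (free_tree K t) (free_tree K s) = koszul_sign t *+ (t == s).
Proof.
rewrite (koszul_formEw _ (free_tree_supp K t)) big_seq_fset1.
by rewrite (free_tree_coef K t t) (free_tree_coef K s t) eqxx mulr1
           [s == t]eq_sym mulr_natr.
Qed.

Lemma koszul_form_gen (x y x' y' : G) (i i' : 'I_2) :
  koszul_form (op_comp (gen K x) i (gen K y))
              (op_comp (gen K x') i' (gen K y')) =
  if [&& x == x', y == y' & i == i'] then (-1) ^+ i else 0.
Proof.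
rewrite (gen_comp K x y i) (gen_comp K x' y' i') koszul_form_tree.
have -> : (wgraft (corolla x) i (corolla y) ==
           wgraft (corolla x') i' (corolla y')) =
          [&& x == x', y == y' & i == i'].
  apply/eqP/and3P => [/(congr1 val) /=|[/eqP-> /eqP-> /eqP->] //].
  case: i i' => [[|[]] // hi] [[|[]] // hi'] /=.
  - by case=> -> ->; rewrite !eqxx.
  - by case=> -> ->; rewrite !eqxx.
case: ifP => _; last by rewrite mulr0n.
by rewrite mulr1n; case: i => [[|[]]].
Qed.

Definition annihilator (R : Free 2%N -> Prop) (g : Free 2%N) : Prop :=
  forall f, R f -> koszul_form f g = 0.

(** The Koszul dual of [presented R], computed from this presentation. *)
Definition koszul_dual (R : Free 2%N -> Prop) : operad K :=
  presented (annihilator R).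

Definition koszul_dual_pi (R : Free 2%N -> Prop) n :
  Free n -> koszul_dual R n := @op_pi _ _ _ (annihilator R) n.

End KoszulDual.

(** The index set [{1, ..., gamma}] is encoded by ['I_gamma], the ordinal [a]
    standing for [a.+1]; this shift is compatible with the order, hence with
    [Order.max]. *)
Section Dias.
Variables (K : fieldType) (gamma : nat).

(** [inl a] indexes the left generator, [inr a] the right one; both an operad and
    its Koszul dual are quotients of the same free operad, so that [leftharp a]
    and [rightharp a] are the elements [dashv a] and [vdash a] under the names
    they bear in the dual. *)
Definition dias_index : choiceType := ('I_gamma + 'I_gamma)%type.

Local Notation Free := (free_operad K dias_index).

Definition dashv (a : 'I_gamma) : Free 1%N := gen K (inl a : dias_index).
Definition vdash (a : 'I_gamma) : Free 1%N := gen K (inr a : dias_index).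

Inductive dias_rel : Free 2%N -> Prop :=
| dias_rel1 a a' : dias_rel (dashv a \o1 vdash a' - vdash a' \o2 dashv a)
| dias_rel2 a a' :
    dias_rel (dashv a \o1 dashv (Order.max a a') - dashv a \o2 vdash a')
| dias_rel3 a a' :
    dias_rel (vdash a \o1 dashv a' - vdash a \o2 vdash (Order.max a a'))
| dias_rel4 a a' :
    dias_rel (dashv (Order.max a a') \o1 dashv a - dashv a \o2 dashv a')
| dias_rel5 a a' :
    dias_rel (vdash a \o1 vdash a' - vdash (Order.max a a') \o2 vdash a).

Definition dias_space : Free 2%N -> Prop := lspan dias_rel.

Definition Dias : operad K := presented dias_space.

Definition Dendr : operad K := koszul_dual dias_space.

Definition leftharp (a : 'I_gamma) : Free 1%N := gen K (inl a : dias_index).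
Definition rightharp (a : 'I_gamma) : Free 1%N := gen K (inr a : dias_index).

Definition Dendr_pi n : Free n -> Dendr n :=
  @koszul_dual_pi K dias_index dias_space n.

End Dias.

Arguments leftharp {K gamma} a.
Arguments rightharp {K gamma} a.
Arguments Dendr_pi {K gamma n} x.

(* Main.v *)
(** The form sends [x o_1 y] to [1] and [x o_2 y] to [-1], so pairing with
    [S o_1 S - S o_2 S], where [S] is the sum of a set [s] of generators, maps
    both [x o_1 y] and [x o_2 y] to the truth value of [x, y \in s].  For [s]
    the generators of index at most [b], the two terms of each relation of
    [Dias] get the same value, because [max a a' <= b] means [a <= b] and
    [a' <= b].  Hence [S o_1 S - S o_2 S] is a relation of [Dendr]. *)
Require Import Defs.
From mathcomp Require Import all_boot all_order all_algebra.

Set Implicit Arguments.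
Unset Strict Implicit.
Unset Printing Implicit Defensive.

Import GRing.Theory.
Local Open Scope ring_scope.

Lemma linear_fun_sum (K : fieldType) (U V : lmodType K) (f : U -> V)
    (I : Type) (r : seq I) (P : pred I) (F : I -> U) : linear f ->
  f (\sum_(i <- r | P i) F i) = \sum_(i <- r | P i) f (F i).
Proof.
move=> lf; apply: big_morph; last exact: linear_fun0.
by move=> u v; rewrite -[u]scale1r lf !scale1r.
Qed.

Lemma linear_funB (K : fieldType) (U V : lmodType K) (f : U -> V) (u v : U) :
  linear f -> f (u - v) = f u - f v.
Proof. by move=> lf; rewrite addrC -scaleN1r lf scaleN1r addrC. Qed.

Section GeneratorSums.
Variables (K : fieldType) (G : choiceType).
Local Notation Free := (free_operad K G).

(** The codomain is [K^o], the field as a module over itself, so that the lemmas on linear maps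
    between modules apply. *)
Lemma koszul_form_linearl (g : Free 2%N) :
  linear (fun f : Free 2%N => koszul_form f g : K^o).
Proof. by move=> a f f'; exact: koszul_form_linl. Qed.

Lemma koszul_form_linearr (f : Free 2%N) :
  linear (fun g : Free 2%N => koszul_form f g : K^o).
Proof. by move=> a g g'; exact: koszul_form_linr. Qed.

(** The projection commutes with partial composition and kills the annihilator of [R]. *)
Lemma koszul_dual_associative (R : Free 2%N -> Prop) (x : Free 1%N) :
  annihilator R (x \o1 x - x \o2 x) ->
  associative_elt (koszul_dual_pi R x : koszul_dual R 1%N).
Proof.
move=> Rx; rewrite /associative_elt /koszul_dual_pi /op_pi.
have pi_comp i := @qop_pi_comp _ _ _ (annihilator R) 1 1 x i x.
apply: etrans (esym (pi_comp ord0)) _; apply: etrans _ (pi_comp ord_max).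
by apply/qop_piE; exact: op_ideal_rel.
Qed.

Lemma annihilator_lspan (R : Free 2%N -> Prop) (g : Free 2%N) :
  annihilator R g -> annihilator (lspan R) g.
Proof.
move=> Rg f; elim=> {f} [f /Rg //||a f f' _ IHf _ IHf'].
  exact: (linear_fun0 (koszul_form_linearl g)).
by rewrite koszul_form_linl IHf IHf' mulr0 addr0.
Qed.

Variable s : seq G.
Hypothesis s_uniq : uniq s.
Let S : Free 1%N := \sum_(x <- s) gen K x.

Lemma op_comp_gen_sum (i : 'I_2) :
  op_comp S i S = \sum_(x <- s) \sum_(y <- s) op_comp (gen K x) i (gen K y).
Proof.
rewrite (linear_fun_sum _ _ _ (op_comp_linl i S)); apply: eq_bigr => x _.
exact: linear_fun_sum (op_comp_linr _ _).
Qed.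

Lemma koszul_form_gen_sum (x y : G) (i j : 'I_2) :
  koszul_form (op_comp (gen K x) i (gen K y)) (op_comp S j S) =
  if i == j then (-1) ^+ i * ((x \in s) && (y \in s))%:R else 0.
Proof.
(* The sum counts the occurrences of [z], at most one since [s] is duplicate-free. *)
have sum_mem z : \sum_(t <- s) (z == t)%:R = (z \in s)%:R :> K.
  rewrite -(count_uniq_mem z s_uniq) -sum1_count natr_sum [RHS]big_mkcond /=.
  by apply: eq_bigr => t _; rewrite eq_sym; case: ifP.
rewrite op_comp_gen_sum (linear_fun_sum _ _ _ (koszul_form_linearr _)).
under eq_bigr => z _.
  rewrite (linear_fun_sum _ _ _ (koszul_form_linearr _)).
  under eq_bigr => t _.
    rewrite koszul_form_gen.
    (* Writing the condition as a product of indicators separates the sums over [z] and [t]. *)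
    have -> : (if [&& x == z, y == t & i == j] then (-1) ^+ i else 0) =
              (if i == j then (-1) ^+ i else 0) * (x == z)%:R * (y == t)%:R :> K.
      by case: (x == z); case: (y == t); case: (i == j);
         rewrite /= ?(mulr1, mulr0, mul0r).
    over.
  rewrite -mulr_sumr sum_mem mulrAC; over.
rewrite -mulr_sumr sum_mem mulrAC -mulrA -natrM mulnb.
by case: ifP => // _; rewrite mul0r.
Qed.

Lemma koszul_form_gen_associator (x y : G) (i : 'I_2) :
  koszul_form (op_comp (gen K x) i (gen K y)) (S \o1 S - S \o2 S) =
  ((x \in s) && (y \in s))%:R.
Proof.
rewrite (linear_funB _ _ (koszul_form_linearr _)) !koszul_form_gen_sum.
by case: i => [[|[|//]] lti] /=; rewrite ?subr0 ?sub0r ?mul1r ?mulN1r ?opprK.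
Qed.

End GeneratorSums.

(* [b : 'I_gamma] stands for [b.+1] in [{1, ..., gamma}], so that the indices
   [a] in [{1, ..., b.+1}] are the ordinals with [a <= b]. *)
Theorem proposition4p1p3 (K : fieldType) (charK0 : [pchar K] =i pred0)
    (gamma : nat) (b : 'I_gamma) :
  associative_elt
    (Dendr_pi (\sum_(a : 'I_gamma | (a <= b)%N) (leftharp a + rightharp a))
       : Dendr K gamma 1).
Proof.
pose e := [seq a : 'I_gamma <- index_enum 'I_gamma | (a <= b)%N].
pose s : seq (dias_index gamma) := [seq inl a | a <- e] ++ [seq inr a | a <- e].
have e_uniq : uniq e by rewrite filter_uniq // index_enum_uniq.
have s_uniq : uniq s.
  rewrite cat_uniq !map_inj_uniq ?e_uniq; try by move=> ? ? [].
  by rewrite andbT; apply/hasPn => _ /mapP[a _ ->]; apply/mapP => -[].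
have e_mem (a : 'I_gamma) : (a \in e) = (a <= b)%N.
  by rewrite mem_filter mem_index_enum andbT.
have s_inl a : (inl a \in s) = (a <= b)%N.
  rewrite mem_cat mem_map ?e_mem; last by move=> ? ? [].
  (* No [inl a] is in the image of [inr], so the second half of [s] contributes nothing. *)
  by apply/orb_idr => /mapP[].
have s_inr a : (inr a \in s) = (a <= b)%N.
  rewrite mem_cat orbC mem_map ?e_mem; last by move=> ? ? [].
  by apply/orb_idr => /mapP[].
have max_le (a a' : 'I_gamma) :
    (Order.max a a' <= b)%N = (a <= b)%N && (a' <= b)%N.
  (* The order on ordinals is, by conversion, that of their values. *)
  exact: Order.TotalTheory.ge_max b a a'.
have -> : \sum_(a : 'I_gamma | (a <= b)%N) (leftharp a + rightharp a) =
          \sum_(x <- s) gen K x.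
  rewrite big_cat !big_map big_split.
  by rewrite -!(big_filter _ (fun a : 'I_gamma => a <= b)%N).
(* By linearity it is enough to test the five spanning families; each reduces to a Boolean identity
   such as [p && (p && q) = p && q]. *)
apply/koszul_dual_associative/annihilator_lspan => _ [] a a';
  rewrite (linear_funB _ _ (koszul_form_linearl _));
  rewrite !koszul_form_gen_associator //;
  rewrite ?(s_inl, s_inr) ?max_le;
  by case: (a <= b)%N; case: (a' <= b)%N; rewrite subrr.
Qed.
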